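(* Let $n\ge 1$, let $f(x)=x^TAx+2a^Tx+a_0$ be a non-constant function on $\mathbb{R}^n$ ($A$ real symmetric $n\times n$, $a\in\mathbb{R}^n$, $a_0\in\mathbb{R}$), and let $h:\mathbb{R}^n\to\mathbb{R}$ be an affine function. Then $\{h=0\}$ separates $\{f=0\}$ if and only if, for at least one choice of sign $\sigma\in\{+1,-1\}$, there exist an invertible affine change of coordinates $x=Py+p$ ($P\in\mathbb{R}^{n\times n}$ invertible, $p\in\mathbb{R}^n$), a scalar $\mu>0$, an integer $m$ with $1\le m\le n$, $\delta\in\{0,1\}$ and real numbers $c_0,c_1,\dots,c_m$ such that: (i) $\sigma\mu f(Py+p)=-y_1^2+\delta(y_2^2+\cdots+y_m^2)+1$ for all $y\in\mathbb{R}^n$; (ii) $h(Py+p)=c_1y_1+\delta(c_2y_2+\cdots+c_my_m)+c_0$ for all $y\in\mathbb{R}^n$, with $c_1\neq 0$; (iii) the restriction of $\sigma\mu f$ to $\{h=0\}$ is everywhere positive, that is, $$-\left(\delta\sum_{i=2}^{m}\frac{c_i}{c_1}y_i+\frac{c_0}{c_1}\right)^2+\delta\sum_{i=2}^{m}y_i^2+1>0\qquad\text{for all }(y_2,\dots,y_n)^T\in\mathbb{R}^{n-1}.$$ Consequently, if $h$ is affine, then $\{h=0\}$ separates $\{f=0\}$ if and only if either $\{h=0\}$ separates $\{f\le 0\}$ or $\{h=0\}$ separates $\{-f\le 0\}$.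
   Context: For a function $p:\mathbb{R}^n\to\mathbb{R}$ and $\star\in\{<,\le,=\}$ write $\{p\star 0\}=\{x\in\mathbb{R}^n: p(x)\star 0\}$. For functions $p,q:\mathbb{R}^n\to\mathbb{R}$, the level set $\{q=0\}$ is said to separate $\{p\star 0\}$ if there are non-empty subsets $L^-,L^+$ of $\{p\star 0\}$ such that $\{p\star 0\}=L^-\cup L^+$ and $q(u)q(v)<0$ for all $u\in L^-$ and all $v\in L^+$. *)

(* Defs.v *)
From HB Require Import structures.
From mathcomp Require Import all_boot all_order all_algebra.
From mathcomp Require Import classical_sets reals.
Set Implicit Arguments.
Unset Strict Implicit.
Unset Printing Implicit Defensive.
Import Order.TTheory GRing.Theory Num.Theory.

Local Open Scope classical_set_scope.
Local Open Scope ring_scope.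

Definition quadratic_fun (R : realType) (n : nat)
    (A : 'M[R]_n) (a : 'cV[R]_n) (a0 : R) (x : 'cV[R]_n) : R :=
  (x^T *m A *m x) 0 0 + 2 * (a^T *m x) 0 0 + a0.

(* Constant functions ([b = 0]) count as affine. *)
Definition affine_fun (R : realType) (n : nat) (h : 'cV[R]_n -> R) : Prop :=
  exists (b : 'cV[R]_n) (b0 : R), forall x, h x = (b^T *m x) 0 0 + b0.

(* The level set [{q = 0}] separates the set [S]. *)
Definition separates (R : realType) (n : nat)
    (q : 'cV[R]_n -> R) (S : set 'cV[R]_n) : Prop :=
  exists Lm Lp : set 'cV[R]_n,
    [/\ Lm !=set0, Lp !=set0, S = Lm `|` Lp &
        forall u v, Lm u -> Lp v -> q u * q v < 0].

(* Main.v *)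
(* If {h = 0} separates {f = 0}, then f has no zero on the hyperplane {h = 0},
   hence a constant sign there; let g be whichever of f, -f is positive on it.
   As long as some direction v parallel to the hyperplane has v^T A v > 0,
   subtract from g the square of its normalized derivative along v.  What
   remains is the minimum of g along v: it is still positive on {h = 0}, it is
   still nonpositive somewhere on each side, and the rank of A drops by one.
   When no such v is left, positivity makes g constant on the hyperplane, so
   g = k + h e with e affine and k > 0.  If e and h have independent linear
   parts, h e = ((h + e) / 2)^2 - ((h - e) / 2)^2; otherwise g is a quadratic
   polynomial in h, nonpositive somewhere on each side, and completing the square
   gives k' - l^2.  The affine forms obtained this way have independent linear
   parts and extend to coordinates. *)

Require Import Defs.
From HB Require Import structures.
From mathcomp Require Import all_boot all_order all_algebra.
From mathcomp Require Import classical_sets reals boolp.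
From mathcomp Require Import ring lra zify.
Set Implicit Arguments.
Unset Strict Implicit.
Unset Printing Implicit Defensive.
Import Order.TTheory GRing.Theory Num.Theory.

Local Open Scope classical_set_scope.
Local Open Scope ring_scope.

(** * Separation as a condition on signs *)

Lemma separatesP (R : realType) (n : nat) (q : 'cV[R]_n -> R) (S : set 'cV[R]_n) :
  separates q S <->
  [/\ forall x, S x -> q x != 0, exists2 u, S u & q u < 0 &
      exists2 v, S v & 0 < q v].
Proof.
split=> [[Lm [Lp [[u Lu] [v Lv] -> quv]]]|[q0 [u Su qu] [v Sv qv]]].
  split.
  - move=> x [] Lx; apply/eqP => qx.
      by have := quv _ _ Lx Lv; rewrite qx mul0r ltxx.
    by have := quv _ _ Lu Lx; rewrite qx mulr0 ltxx.
  (* The product condition does not tell which of the two sets carries the negative sign. *)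
  - case: (ltP (q u) 0) => [qu|qu]; first by exists u => //; left.
    by exists v; [right|have := quv _ _ Lu Lv; nra].
  - case: (ltP 0 (q u)) => [qu|qu]; first by exists u => //; left.
    by exists v; [right|have := quv _ _ Lu Lv; nra].
exists [set x | S x /\ q x < 0], [set x | S x /\ 0 < q x]; split.
- by exists u.
- by exists v.
- apply/seteqP; split => x /= => [Sx|[[]|[]] //].
  by case: (ltgtP (q x) 0) (q0 x Sx) => // qx _; [left|right].
- by move=> x y [_ qx] [_ qy]; nra.
Qed.

(** * Bilinear forms, and quadratic functions along lines *)

Section Forms.
Variables (R : realType) (n : nat).
Implicit Types (A : 'M[R]_n) (a b u v x y : 'cV[R]_n).

Definition dot a x : R := (a^T *m x) 0 0.
Definition form A x y : R := (x^T *m A *m y) 0 0.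

Lemma dotDr a x y : dot a (x + y) = dot a x + dot a y.
Proof. by rewrite /dot mulmxDr mxE. Qed.

Lemma dotZr a s x : dot a (s *: x) = s * dot a x.
Proof. by rewrite /dot -scalemxAr mxE. Qed.

Lemma dotC a x : dot a x = dot x a.
Proof.
rewrite /dot !mxE; apply: eq_bigr => i _.
by rewrite !mxE mulrC.
Qed.

Lemma dotDl a b x : dot (a + b) x = dot a x + dot b x.
Proof. by rewrite !(dotC _ x) dotDr. Qed.

Lemma dotZl s a x : dot (s *: a) x = s * dot a x.
Proof. by rewrite !(dotC _ x) dotZr. Qed.

Lemma dot_gt0 a : a != 0 -> 0 < dot a a.
Proof.
move=> a0; have -> : dot a a = \sum_i a i 0 ^+ 2.
  by rewrite /dot mxE; apply: eq_bigr => i _; rewrite !mxE expr2.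
rewrite lt0r sumr_ge0 ?andbT; last by move=> i _; exact: sqr_ge0.
apply: contraNneq a0 => /eqP.
rewrite psumr_eq0 => [/allP s0|i _]; last exact: sqr_ge0.
apply/eqP/colP => i; rewrite !mxE; apply/eqP.
by rewrite -sqrf_eq0; apply: s0; rewrite mem_index_enum.
Qed.

Lemma formE A x y : form A x y = dot x (A *m y).
Proof. by rewrite /form /dot mulmxA. Qed.

Lemma formC A x y : A^T = A -> form A x y = form A y x.
Proof. by move=> As; rewrite !formE dotC /dot trmx_mul As -mulmxA. Qed.

Lemma formDr A x y z : form A x (y + z) = form A x y + form A x z.
Proof. by rewrite !formE mulmxDr dotDr. Qed.

Lemma formZr A x s y : form A x (s *: y) = s * form A x y.
Proof. by rewrite !formE -scalemxAr dotZr. Qed.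

Lemma formDl A x y z : form A (x + y) z = form A x z + form A y z.
Proof. by rewrite !formE dotDl. Qed.

Lemma formZl A s x y : form A (s *: x) y = s * form A x y.
Proof. by rewrite !formE dotZl. Qed.

Definition form_linE := (formDr, formZr, formDl, formZl, dotDr, dotZr, dotDl, dotZl).

Lemma quadratic_funE A a (a0 : R) x :
  quadratic_fun A a a0 x = form A x x + 2 * dot a x + a0.
Proof. by []. Qed.

Lemma quadratic_fun_line A a (a0 : R) x v s : A^T = A ->
  quadratic_fun A a a0 (x + s *: v) =
  quadratic_fun A a a0 x + 2 * s * (form A v x + dot a v) + s ^+ 2 * form A v v.
Proof.
by move=> As; rewrite !quadratic_funE !form_linE (formC x v As); ring.
Qed.

(** On the segment the function is a polynomial in the parameter, so the intermediate value theorem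
    for polynomials applies. *)
Lemma quadratic_fun_ivt A a (a0 : R) x y : A^T = A ->
  quadratic_fun A a a0 x <= 0 <= quadratic_fun A a a0 y ->
  exists2 s, 0 <= s <= 1 & quadratic_fun A a a0 (x + s *: (y - x)) = 0.
Proof.
move=> As fxy; set g := quadratic_fun A a a0; set v := y - x.
pose P : {poly R} := (g x)%:P + (2 * (form A v x + dot a v)) *: 'X + form A v v *: 'X^2.
have PE s : P.[s] = g (x + s *: v).
  by rewrite /g quadratic_fun_line // /P !hornerD !hornerZ hornerC hornerXn hornerX -/g; ring.
have P01 : P.[0] <= 0 <= P.[1].
  by rewrite !PE scale0r addr0 scale1r /v addrC subrK.
have [s s01 /rootP] := poly_ivt ler01 P01.
by rewrite PE => gs; exists s.
Qed.

Lemma quadratic_fun_opp A a (a0 : R) x :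
  quadratic_fun (- A) (- a) (- a0) x = - quadratic_fun A a a0 x.
Proof.
rewrite !quadratic_funE -[- A]scaleN1r -[- a]scaleN1r dotZl !formE -scalemxAl dotZr; ring.
Qed.

Lemma affine_zero b (b0 : R) u v : dot b u + b0 < 0 -> 0 < dot b v + b0 ->
  exists x, dot b x + b0 = 0.
Proof.
move=> hu hv; exists (u + (- (dot b u + b0) / (dot b v - dot b u)) *: (v - u)).
rewrite -scaleN1r !form_linE; field.
by apply/eqP => e; lra.
Qed.

End Forms.

(** * Completing independent families to bases *)

Section FreeFamilies.
Variables (F : fieldType) (n : nat).
Implicit Types (l : nat -> 'rV[F]_n) (w : 'rV[F]_n) (m : nat).

Definition rows l m : 'M[F]_(m, n) := \matrix_(i < m) l i.

(** Families are indexed by [nat] and their length is kept apart, so that appending does not change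
    the type; entries beyond [m] are filler. *)
Definition snoc T (l : nat -> T) m (t : T) i := if (i < m)%N then l i else t.

Lemma snoc_lt T (l : nat -> T) m t i : (i < m)%N -> snoc l m t i = l i.
Proof. by rewrite /snoc => ->. Qed.

Lemma snoc_last T (l : nat -> T) m t : snoc l m t m = t.
Proof. by rewrite /snoc ltnn. Qed.

Lemma row_free_rows0 l : row_free (rows l 0).
Proof. by rewrite /row_free -leqn0 rank_leq_row. Qed.

(** In a linear relation, a nonzero coefficient at [w] would put [w] in the span of the old rows; a
    zero one leaves a relation among independent rows. *)
Lemma row_free_snoc l m w : row_free (rows l m) -> ~~ (w <= rows l m)%MS ->
  row_free (rows (snoc l m w) m.+1).
Proof.
move=> lf wl; rewrite -kermx_eq0; apply/rowV0P => u /sub_kermxP.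
rewrite mulmx_sum_row big_ord_recr /= rowK /= snoc_last.
pose u' := \row_(i < m) u 0 (widen_ord (leqnSn m) i).
have -> : \sum_(i < m) u 0 (widen_ord (leqnSn m) i) *:
    row (widen_ord (leqnSn m) i) (rows (snoc l m w) m.+1) = u' *m rows l m.
  rewrite mulmx_sum_row; apply: eq_bigr => i _.
  by rewrite !rowK mxE /= snoc_lt.
move=> u0; have um : u 0 ord_max = 0.
  apply: contraNeq wl => um.
  have -> : w = - (u 0 ord_max)^-1 *: (u' *m rows l m).
    have -> : u' *m rows l m = - (u 0 ord_max *: w) by apply/eqP; rewrite -addr_eq0 u0.
    by rewrite scaleNr scalerN opprK scalerA mulVf // scale1r.
  by apply: scalemx_sub; exact: submxMl.
move: u0; rewrite um scale0r addr0 => /eqP; rewrite mulmx_free_eq0 // => /eqP u'0.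
apply/rowP => i; rewrite mxE; case: (unliftP ord_max i) => [j ->|-> //].
have /rowP /(_ j) := u'0; rewrite !mxE => <-; congr (u 0 _).
by apply: val_inj; rewrite /= /bump leqNgt ltn_ord.
Qed.
Lemma row_free_rows1 l : l 0%N != 0 -> row_free (rows l 1).
Proof.
move=> l0; have -> : rows l 1 = rows (snoc l 0 (l 0%N)) 1.
  by apply/row_matrixP => i; rewrite !rowK /snoc ord1.
apply: row_free_snoc (row_free_rows0 l) _.
by apply: contraNN l0 => /submxP[u ->]; rewrite [u]thinmx0 mul0mx.
Qed.

Lemma row_free_rows2 l : l 0%N != 0 -> ~~ (l 1%N <= l 0%N)%MS -> row_free (rows l 2).
Proof.
move=> l0 l1; have -> : rows l 2 = rows (snoc l 1 (l 1%N)) 2.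
  apply/row_matrixP => i; rewrite !rowK /snoc; case: ltnP => // i1.
  by congr l; apply/eqP; rewrite eqn_leq i1 -ltnS ltn_ord.
apply: row_free_snoc (row_free_rows1 l0) _.
by have -> : rows l 1 = l 0%N by apply/rowP => i; rewrite mxE.
Qed.

Lemma row_free_extend l m : row_free (rows l m) ->
  exists2 l', row_free (rows l' n) & forall i, (i < m)%N -> l' i = l i.
Proof.
move: {2}(n - m)%N (leqnn (n - m)%N) => k; elim: k l m => [|k IH] l m.
  rewrite leqn0 subn_eq0 => nm lf; exists l => //.
  have mn : (m <= n)%N by move: (lf); rewrite /row_free => /eqP <-; apply: rank_leq_col.
  by move: lf; have -> : m = n by apply/eqP; rewrite eqn_leq nm mn.
move=> nmk lf; have [nm|mn] := leqP n m; first by apply: IH => //; lia.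
(* Fewer than [n] rows cannot span the space, so they miss some standard basis vector. *)
have [w wl] : exists w, ~~ (w <= rows l m)%MS.
  have /row_subPn[i] : ~~ (1%:M <= rows l m)%MS.
    by rewrite sub1mx /row_full (eqP lf) neq_ltn mn.
  by exists (row i 1%:M).
have [||l' l'f l'E] := IH (snoc l m w) m.+1; first by lia.
  exact: row_free_snoc.
by exists l' => // i im; rewrite l'E ?snoc_lt // ltnW.
Qed.

End FreeFamilies.

(** * Signed sums of squares of independent affine forms *)

Section NormalForm.
Variables (R : realType) (n : nat).
Implicit Types (A : 'M[R]_n) (a b u v w x y : 'cV[R]_n).

Definition aff (l : nat -> 'cV[R]_n * R) i x : R := dot (l i).1 x + (l i).2.

Definition lin_rows (l : nat -> 'cV[R]_n * R) : nat -> 'rV[R]_n :=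
  fun i => (l i).1^T.

Lemma dot_mulmx A u x : A^T = A -> dot (A *m u) x = form A u x.
Proof. by move=> As; rewrite /dot /form trmx_mul As. Qed.

Lemma form_rank1 w x y : form (w *m w^T) x y = dot w x * dot w y.
Proof.
rewrite /form mulmxA -mulmxA [x^T *m w]mx11_scalar mul_scalar_mx mxE.
by rewrite -/(dot x w) dotC.
Qed.

Lemma quadratic_fun_subsqr A a (a0 : R) w (w0 : R) x :
  quadratic_fun (A - w *m w^T) (a - w0 *: w) (a0 - w0 ^+ 2) x =
  quadratic_fun A a a0 x - (dot w x + w0) ^+ 2.
Proof.
have formB B C : form (B - C) x x = form B x x - form C x x.
  by rewrite !formE mulmxBl -scaleN1r !form_linE mulN1r.
rewrite !quadratic_funE formB form_rank1 -[- (_ *: _)]scaleN1r !form_linE; ring.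
Qed.

Lemma pos_quadratic (k be q : R) : (forall s, 0 < k + 2 * s * be + s ^+ 2 * q) ->
  0 <= q /\ (q = 0 -> be = 0).
Proof.
move=> pos; have k0 : 0 < k by have := pos 0; rewrite expr0n !(mulr0, mul0r) !addr0.
split=> [|q0].
  case: (leP 0 q) => // q0.
  (* At opposite points the linear terms cancel in the sum of the two values; 1 - k/q is large
     enough to make that sum negative when q < 0. *)
  have /= p1 := pos (1 - k / q); have /= p2 := pos (- (1 - k / q)).
  have kq : k / q * q = k by rewrite mulfVK // lt_eqF.
  have kq0 : k / q < 0 by rewrite pmulr_rlt0 // invr_lt0.
  move: p1 p2 kq kq0; set t := k / q => p1 p2 kq kq0.
  have : 0 < 2 * k + 2 * (1 - t) ^+ 2 * q by nra.
  have -> : 2 * k + 2 * (1 - t) ^+ 2 * q = 2 * k + 2 * (1 - t) * (q - t * q) by ring.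
  rewrite kq; nra.
(* With [q] = 0 and [be] nonzero, this point is the root of the remaining affine function. *)
apply/eqP; case: eqVneq => // be0; have := pos (- k / (2 * be)).
rewrite q0; have -> : k + 2 * (- k / (2 * be)) * be + (- k / (2 * be)) ^+ 2 * 0 = 0 by field.
by rewrite ltxx.
Qed.

(* The linear parts vanish on [K]: in the reduction step the vector [v] lies in
   [K] but is not killed by the new form, which is therefore independent of the
   previous ones. *)
Definition normalized (g h : 'cV[R]_n -> R) (K : 'cV[R]_n -> Prop) : Prop :=
  exists m (k : R) (l : nat -> 'cV[R]_n * R) (s : nat -> R) (s0 : R),
    [/\ 0 < k, row_free (rows (lin_rows l) m.+1),
        forall v, K v -> forall i, (i <= m)%N -> dot (l i).1 v = 0 & s 0%N != 0] /\
    forall x, g x = k - aff l 0 x ^+ 2 + \sum_(1 <= i < m.+1) aff l i x ^+ 2 /\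
              h x = \sum_(0 <= i < m.+1) s i * aff l i x + s0.

Lemma rows_snoc m (l : nat -> 'cV[R]_n * R) (t : 'cV[R]_n * R) :
  rows (lin_rows (snoc l m t)) m.+1 = rows (snoc (lin_rows l) m t.1^T) m.+1.
Proof. by apply/row_matrixP => i; rewrite !rowK /lin_rows /snoc; case: ifP. Qed.

Lemma normalized_addsqr (g h : 'cV[R]_n -> R) (K K' : 'cV[R]_n -> Prop) v w (w0 : R) :
  normalized (fun x => g x - (dot w x + w0) ^+ 2) h K ->
  K v -> dot w v != 0 -> (forall x, K' x -> K x /\ dot w x = 0) ->
  normalized g h K'.
Proof.
move=> [m [k [l [s [s0 [[k0 lf lK s00] E]]]]]] Kv wv K'K.
(* The new form gets coefficient 0 in the expansion of [h], which thus stays the same. *)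
exists m.+1, k, (snoc l m.+1 (w, w0)), (snoc s m.+1 0), s0; split; first split.
- by [].
- rewrite rows_snoc row_free_snoc //=; apply/negP => /submxP[u wE].
  move/eqP: wv; apply; rewrite /dot wE -mulmxA.
  have -> : rows (lin_rows l) m.+1 *m v = 0.
    apply/colP => i; rewrite [RHS]mxE -(lK v Kv i) -1?ltnS //.
    rewrite /dot !mxE; apply: eq_bigr => j _.
    by rewrite !mxE.
  by rewrite mulmx0 mxE.
- move=> x /K'K[Kx wx] i; rewrite leq_eqVlt => /orP[/eqP->|im].
    by rewrite snoc_last.
  by rewrite snoc_lt // lK.
- by rewrite snoc_lt.
move=> x; have [/eqP gx hx] := E x; rewrite subr_eq in gx.
have affE i : (i < m.+1)%N -> aff (snoc l m.+1 (w, w0)) i x = aff l i x.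
  by move=> im; rewrite /aff snoc_lt.
have affL : aff (snoc l m.+1 (w, w0)) m.+1 x = dot w x + w0.
  by rewrite /aff snoc_last.
split.
  rewrite big_nat_recr // affL affE // (eqP gx) addrA.
  by congr (_ + _ + _); apply: eq_big_nat => i /andP[_ im]; rewrite affE.
rewrite hx [in RHS]big_nat_recr // (snoc_last s) mul0r /= addr0.
by congr (_ + _); apply: eq_big_nat => i im; rewrite affE // snoc_lt.
Qed.

End NormalForm.

(** If c >= 0, both values can be nonpositive only if e s < 0 and e t < 0, which is impossible for s
    < 0 < t. *)
Lemma quadratic_roots_sign (R : realType) (k c e s t : R) : 0 < k -> s < 0 -> 0 < t ->
  k + c * s ^+ 2 + e * s <= 0 -> k + c * t ^+ 2 + e * t <= 0 -> c < 0.
Proof.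
move=> k0 s0 t0 ps pt; rewrite ltNge; apply/negP => c0.
have cs : 0 <= c * s ^+ 2 by rewrite mulr_ge0 ?sqr_ge0.
have ct : 0 <= c * t ^+ 2 by rewrite mulr_ge0 ?sqr_ge0.
by case: (leP 0 e) => e0; nra.
Qed.

(** * Reduction to the normal form by induction on the rank *)

Section Reduction.
Variables (R : realType) (n : nat) (b : 'cV[R]_n) (b0 : R).
Implicit Types (A : 'M[R]_n) (a u v w x y : 'cV[R]_n).

Let h x := dot b x + b0.

Lemma normalized_base A a (a0 : R) : A^T = A ->
  (forall v, dot b v = 0 -> form A v v <= 0) ->
  (forall x, h x = 0 -> 0 < quadratic_fun A a a0 x) ->
  (exists2 u, h u < 0 & quadratic_fun A a a0 u <= 0) ->
  (exists2 v, 0 < h v & quadratic_fun A a a0 v <= 0) ->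
  normalized (quadratic_fun A a a0) h (fun v => A *m v = 0 /\ dot b v = 0).
Proof.
move=> As Ab gpos [u0 hu0 gu0] [v0 hv0 gv0].
have [x0 hx0] := affine_zero hu0 hv0.
set g := quadratic_fun A a a0 in gpos gu0 gv0 *.
have k0 := gpos _ hx0; set k := g x0 in k0.
have bn0 : b != 0.
  apply/eqP => b_eq0; move: hu0 hv0.
  by rewrite /h b_eq0 !(dotC 0) /dot !mulmx0 mxE; lra.
(* A positive quadratic along a line in the hyperplane has a nonnegative leading coefficient; here
   it is also nonpositive, so it vanishes, and the slope with it. *)
have flat v : dot b v = 0 -> form A v v = 0 /\ form A v x0 + dot a v = 0.
  move=> bv; have [|q0 be0] := @pos_quadratic R k (form A v x0 + dot a v) (form A v v).
    move=> s; rewrite -(quadratic_fun_line _ _ _ _ _ As); apply: gpos.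
    by rewrite /h !form_linE bv mulr0 addr0.
  have q00 : form A v v = 0 by apply/eqP; rewrite eq_le Ab.
  by split; last exact: be0.
have [u bu] : exists u, dot b u = 1.
  by exists ((dot b b)^-1 *: b); rewrite dotZr mulVf // gt_eqF // dot_gt0.
set q := form A u u.
(* With t = h x, expanding [g] along the transversal [u] gives k + t (2 form A u x + 2 dot a u - t
   q). Substituting t = dot b x + b0 in the bracket yields [d] and [d0]. *)
have [d dE] : exists d, d = 2 *: (A *m u) - q *: b by eexists.
pose d0 := 2 * dot a u - b0 * q.
have gE x : g x = k + h x * (dot d x + d0).
  (* Split x - x0 into a component [w] parallel to the hyperplane, along which [g] stays equal to
     [k], and a multiple of [u]. *)
  pose t := h x; pose w := x - x0 - t *: u.
  have bw : dot b w = 0.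
    move: hx0; rewrite /w -[- x0]scaleN1r -[- (t *: u)]scaleN1r !form_linE bu /t /h => hx0.
    by lra.
  have xE : x = x0 + 1 *: w + t *: u.
    by rewrite scale1r /w addrA [x0 + _]addrC !subrK.
  have [ww wx] := flat w bw.
  have gw : g (x0 + 1 *: w) = k.
    by rewrite /g quadratic_fun_line // ww wx !mulr0 !addr0.
  have Auw : form A u (x0 + 1 *: w) = form A u x - t * q.
    by rewrite [in RHS]xE [in RHS]formDr formZr -/q addrK.
  have -> : g x = k + 2 * t * (form A u x - t * q + dot a u) + t ^+ 2 * q.
    by rewrite {1}xE [LHS]quadratic_fun_line // -/g gw Auw.
  rewrite dE -[- (q *: b)]scaleN1r !form_linE dot_mulmx // /d0 -/(h x) -/t.
  have -> : dot b x = t - b0 by rewrite /t /h addrK.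
  by ring.
have hE x : dot b x = h x - b0 by rewrite /h addrK.
have Kd v : A *m v = 0 -> dot b v = 0 -> dot d v = 0.
  move=> Av bv; rewrite dE -[- (q *: b)]scaleN1r !form_linE dot_mulmx // bv.
  by rewrite formE Av /dot mulmx0 mxE !mulr0 addr0.
case: (boolP (d^T <= b^T)%MS) => [/sub_rVP[c dbE]|db].
  have {dE dbE}dE : d = c *: b by rewrite -[d]trmxK dbE linearZ /= trmxK.
  pose e0 := d0 - c * b0.
  have {}gE x : g x = k + c * h x ^+ 2 + e0 * h x.
    by rewrite gE dE dotZl hE /e0; ring.
  have c0 : c < 0.
    by apply: (@quadratic_roots_sign R k c e0 (h u0) (h v0)); rewrite -?gE.
  pose r := Num.sqrt (- c).
  have r0 : 0 < r by rewrite sqrtr_gt0 oppr_gt0.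
  have r2 : r ^+ 2 = - c by rewrite sqr_sqrtr // oppr_ge0 ltW.
  (* Completing the square in k + c h^2 + e0 h with c = - r^2; the single form is r (h + e0 / (2c)),
     and solving for [h] gives the coefficients. *)
  exists 0%N, (k - e0 ^+ 2 / (4 * c)), (fun=> (r *: b, r * (b0 + e0 / (2 * c)))),
    (fun=> r^-1), (- e0 / (2 * c)); split; first split.
  - rewrite ltr_wpDr // oppr_ge0 mulr_ge0_le0 ?sqr_ge0 // invr_le0.
    by rewrite pmulr_rle0 // ltW.
  - rewrite -[lin_rows _]/(fun=> (r *: b)^T) row_free_rows1 //.
    by rewrite linearZ scaler_eq0 negb_or gt_eqF //= trmx_eq0.
  - by move=> v [_ bv] i _ /=; rewrite dotZl bv mulr0.
  - by rewrite invr_eq0 gt_eqF.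
  move=> x; rewrite /aff /= big_nat1 big_geq // dotZl hE.
  have -> : r * (h x - b0) + r * (b0 + e0 / (2 * c)) = r * (h x + e0 / (2 * c)) by ring.
  split; last by field; rewrite lt_eqF //= gt_eqF.
  rewrite exprMn r2 gE; field.
  by rewrite lt_eqF.
(* Writing e for the affine factor, the forms are (h - e)/2, with the negative square, and (h +
   e)/2; their sum is [h]. *)
exists 1%N, k, (fun i => if i == 0%N then (2^-1 *: (b - d), (b0 - d0) / 2)
                         else (2^-1 *: (b + d), (b0 + d0) / 2)), (fun=> 1), 0; split; first split.
- by [].
- apply: row_free_rows2; rewrite /lin_rows /= !(linearZ _ _) /=.
    rewrite scaler_eq0 invr_eq0 pnatr_eq0 trmx_eq0 subr_eq0 /=.
    by apply: contraNneq db => ->; rewrite submx_refl.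
  rewrite !eqmx_scale ?invr_eq0 ?pnatr_eq0 //.
  (* A relation b + d = c (b - d) means (1 + c) d = (c - 1) b: either [d] is a multiple of [b], or c
     = -1 and b = 0. *)
  apply: contraNN db => /sub_rVP[c]; rewrite [(b + d)^T]raddfD [(b - d)^T]raddfB /= => bdE.
  have dcE : (1 + c) *: d^T = (c - 1) *: b^T.
    rewrite scalerDl scale1r scalerBl scale1r.
    apply/eqP; rewrite -subr_eq0.
    have -> : d^T + c *: d^T - (c *: b^T - b^T) = b^T + d^T - c *: (b^T - d^T).
      by rewrite scalerBr !opprB; apply/rowP => i; rewrite !mxE; ring.
    by rewrite bdE subrr.
  have [c1|c1] := eqVneq (1 + c) 0.
    move/eqP: dcE; rewrite c1 scale0r eq_sym scaler_eq0 trmx_eq0 (negPf bn0) orbF.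
    by move=> /eqP c10; exfalso; clear -c1 c10; lra.
  by rewrite -(eqmx_scale _ c1) dcE scalemx_sub.
- move=> v [Av bv] i _; have dv := Kd v Av bv.
  by case: ifP => _; rewrite /= -?[- d]scaleN1r !form_linE bv dv !(mulr0, addr0).
- exact: oner_neq0.
move=> x; rewrite big_nat1 !big_nat_recr // big_geq //= /aff /=.
rewrite gE -[- d]scaleN1r !form_linE hE; split; first by field.
by field.
Qed.

Lemma normalized_separated A a (a0 : R) : A^T = A ->
  (forall x, h x = 0 -> 0 < quadratic_fun A a a0 x) ->
  (exists2 u, h u < 0 & quadratic_fun A a a0 u <= 0) ->
  (exists2 v, 0 < h v & quadratic_fun A a a0 v <= 0) ->
  normalized (quadratic_fun A a a0) h (fun v => A *m v = 0 /\ dot b v = 0).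
Proof.
move: {2}(\rank A).+1 (ltnSn (\rank A)) => m.
elim: m A a a0 => // m IH A a a0 rA As gpos gneg gneg'.
have [[v bv q0]|nv] := pselect (exists2 v, dot b v = 0 & 0 < form A v v); last first.
  apply: normalized_base => // v bv; rewrite leNgt; apply/negP => q0.
  by apply: nv; exists v.
set q := form A v v in q0; pose r := Num.sqrt q.
have r0 : 0 < r by rewrite sqrtr_gt0.
have r2 : r ^+ 2 = q by rewrite sqr_sqrtr // ltW.
(* The derivative of the function along [v] is 2 r (dot w x + w0), with r^2 = form A v v;
   subtracting the square of dot w x + w0 therefore leaves the minimum along [v]. *)
pose w := r^-1 *: (A *m v); pose w0 := r^-1 * dot a v.
have dwE x : dot w x = r^-1 * form A v x by rewrite dotZl dot_mulmx.
have wv : dot w v = r by rewrite dwE -/q -r2 expr2 mulKf // gt_eqF.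
pose A' := A - w *m w^T.
have A'v : A' *m v = 0.
  rewrite mulmxBl -mulmxA [w^T *m v]mx11_scalar -/(dot w v) wv mul_mx_scalar.
  by rewrite /w scalerA divff ?scale1r ?subrr // gt_eqF.
have dom x : quadratic_fun A a a0 x <= 0 ->
    quadratic_fun A' (a - w0 *: w) (a0 - w0 ^+ 2) x <= 0.
  by rewrite quadratic_fun_subsqr; have := sqr_ge0 (dot w x + w0); lra.
have q_sub x : quadratic_fun A' (a - w0 *: w) (a0 - w0 ^+ 2) x =
    quadratic_fun A a a0 x - (dot w x + w0) ^+ 2 by exact: quadratic_fun_subsqr.
have Kw x : A *m x = 0 -> dot w x = 0.
  by move=> Ax; rewrite dwE formE Ax /dot mulmx0 mxE mulr0.
(* The vector [v] is in the kernel of [A'] and parallel to the hyperplane, yet dot w v = r > 0: this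
   keeps [w] independent of the forms found for [A']. *)
apply: (@normalized_addsqr R n _ h (fun x => A' *m x = 0 /\ dot b x = 0) _ v w w0).
- have -> : (fun x => quadratic_fun A a a0 x - (dot w x + w0) ^+ 2) =
            quadratic_fun A' (a - w0 *: w) (a0 - w0 ^+ 2) by apply/funext => x; rewrite q_sub.
  apply: IH.
  (* The row space of [A'] lies in that of [A]. The inclusion is strict: [A'] kills [v], whereas
     form A v v > 0. *)
  + apply: (@leq_trans (\rank A)) => //; apply: rank_ltmx; rewrite /ltmx; apply/andP; split.
      rewrite /A' addmx_sub // -scaleN1r scalemx_sub //.
      have -> : w^T = r^-1 *: (v^T *m A) by rewrite linearZ /= trmx_mul As.
      by rewrite -scalemxAr scalemx_sub // mulmxA submxMl.
    apply/negP => /submxP[X AE]; move: q0.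
    by rewrite /q formE AE -mulmxA A'v mulmx0 /dot mulmx0 mxE ltxx.
  + by rewrite /A' linearB /= trmx_mul trmxK As.
  + move=> x hx; rewrite q_sub.
    (* The minimum along [v] is attained at a point with the same value of [h], so positivity on the
       hyperplane is inherited. *)
    have -> : quadratic_fun A a a0 x - (dot w x + w0) ^+ 2 =
        quadratic_fun A a a0 (x + (- (dot w x + w0) / r) *: v).
      have e : form A v x + dot a v = r * (dot w x + w0).
        by rewrite dwE -mulrDr mulVKf // gt_eqF.
      by rewrite quadratic_fun_line // e -/q -r2; field; rewrite gt_eqF.
    by apply: gpos; rewrite /h !form_linE bv mulr0 addr0.
  + by case: gneg => x hx /dom; exists x.
  + by case: gneg' => x hx /dom; exists x.
- by [].
- by rewrite wv gt_eqF.
move=> x [Ax bx]; have wx := Kw x Ax; do !split=> //.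
by rewrite mulmxBl Ax -mulmxA [w^T *m x]mx11_scalar -/(dot w x) wx mul_mx_scalar scale0r subr0.
Qed.
End Reduction.

(** * From independent affine forms to coordinates *)

Lemma sum_ord_range (V : nmodType) N m (F : nat -> V) : (m <= N)%N ->
  \sum_(1 <= i < m) F i = \sum_(i < N | (1 <= i < m)%N) F i.
Proof.
move=> mN; rewrite (big_nat_widen _ _ _ _ _ mN) (@big_nat_widenl _ _ _ 1 0) //= big_mkord.
by apply: eq_bigl => i; rewrite andbC.
Qed.

(** The forms are completed to n+1 independent ones and, after division by the square root of [k],
    serve as the coordinates [y]; dividing [g] by [k] makes its constant term 1. *)
Lemma normalized_coordinates (R : realType) n (g h : 'cV[R]_n.+1 -> R) K :
  normalized g h K ->
  exists (P : 'M[R]_n.+1) (p : 'cV[R]_n.+1) (mu : R) (m : nat) (c : nat -> R),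
    [/\ P \in unitmx, 0 < mu, (1 <= m <= n.+1)%N & c 1%N != 0] /\
    forall y : 'cV[R]_n.+1,
      mu * g (P *m y + p) =
        - y 0 0 ^+ 2 + \sum_(i < n.+1 | (1 <= i < m)%N) y i 0 ^+ 2 + 1 /\
      h (P *m y + p) =
        c 1%N * y 0 0 + \sum_(i < n.+1 | (1 <= i < m)%N) c i.+1 * y i 0 + c 0%N.
Proof.
move=> [m [k [l [s [s0 [[k0 lf _ s00] ghE]]]]]].
have mn : (m.+1 <= n.+1)%N by move: (lf); rewrite /row_free => /eqP <-; apply: rank_leq_col.
have [l'] := row_free_extend lf; rewrite row_free_unit => Lu l'E.
set L := rows l' n.+1 in Lu; pose t : 'cV[R]_n.+1 := \col_i (l i).2.
pose r := Num.sqrt k.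
have r0 : 0 < r by rewrite sqrtr_gt0.
have rU : r != 0 by rewrite gt_eqF.
have r2 : r ^+ 2 = k by rewrite sqr_sqrtr // ltW.
(* These solve L x + t = r y for x. The coefficients of [h] are scaled by [r] and shifted by one,
   index 0 being kept for the constant. *)
exists (r *: invmx L), (- (invmx L *m t)), k^-1, m.+1,
  (fun i => if i is j.+1 then s j * r else s0); split.
  split; rewrite ?invr_gt0 ?mulf_neq0 //.
  by rewrite unitmxZ ?unitfE // unitmx_inv.
move=> y; set x := _ + _.
have Lx : L *m x = r *: y - t.
  by rewrite /x mulmxDr mulmxN -scalemxAl -scalemxAr !mulKVmx.
have affE (i : 'I_n.+1) : (i < m.+1)%N -> aff l i x = r * y i 0.
  move=> im; have : (L *m x) i 0 = (r *: y - t) i 0 by rewrite Lx.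
  rewrite !mxE => LxE; rewrite /aff -[r * _](subrK (l i).2) -LxE; congr (_ + _).
  rewrite /dot mxE; apply: eq_bigr => j _; rewrite !mxE l'E //.
  by rewrite /lin_rows mxE.
have aff0 : aff l 0 x = r * y 0 0 := affE 0 isT.
have [gx hx] := ghE x; split.
  rewrite gx aff0 (sum_ord_range (fun i => aff l i x ^+ 2) mn).
  have -> : \sum_(i < n.+1 | (1 <= i < m.+1)%N) aff l i x ^+ 2 =
      k * \sum_(i < n.+1 | (1 <= i < m.+1)%N) y i 0 ^+ 2.
    by rewrite mulr_sumr; apply: eq_bigr => i /andP[_ im]; rewrite affE // exprMn r2.
  by rewrite exprMn r2; field; rewrite gt_eqF.
rewrite hx big_ltn // aff0 (sum_ord_range (fun i => s i * aff l i x) mn) mulrA.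
congr (_ + _ + _); apply: eq_bigr => i /andP[_ im].
by rewrite affE // mulrA.
Qed.

(** * Sign on the hyperplane; zero sets and sublevel sets *)

Lemma separates_zero_sign (R : realType) n (A : 'M[R]_n) a (a0 : R) b (b0 : R) :
  A^T = A ->
  let g := quadratic_fun A a a0 in let h := fun x => dot b x + b0 in
  separates h [set x | g x = 0] ->
  (forall x, h x = 0 -> 0 < g x) \/ (forall x, h x = 0 -> 0 < - g x).
Proof.
move=> As g h /separatesP[/= gh [u gu hu] [v gv hv]].
have [x0 hx0] := affine_zero hu hv.
(* A change of sign within the hyperplane would produce a zero of [g] on a segment contained in it,
   contrary to separation. *)
have noroot x y : h x = 0 -> h y = 0 -> g x <= 0 <= g y -> False.
  move=> hx hy /(quadratic_fun_ivt As)[s _ gs].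
  have /eqP := gh _ gs; apply.
  have -> : h (x + s *: (y - x)) = h x + s * (h y - h x).
    by rewrite /h -scaleN1r !form_linE; ring.
  by rewrite hx hy subrr mulr0 addr0.
case: (leP (g x0) 0) => g0; [right|left] => x hx.
  rewrite oppr_gt0 ltNge; apply/negP => gx.
  by apply: (noroot x0 x) => //; rewrite g0.
rewrite ltNge; apply/negP => gx.
by apply: (noroot x x0) => //; rewrite gx ltW.
Qed.

(** Moving from a point with g <= 0 towards a point of the hyperplane, where g > 0, one meets a zero
    of [g] before changing sides. *)
Lemma separates_zero_of_sublevel (R : realType) n (A : 'M[R]_n) a (a0 : R) b (b0 : R) :
  A^T = A ->
  let g := quadratic_fun A a a0 in let h := fun x => dot b x + b0 in
  separates h [set x | g x <= 0] -> separates h [set x | g x = 0].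
Proof.
move=> As g h /separatesP[/= gh [u gu hu] [v gv hv]].
have [x0 hx0] := affine_zero hu hv.
have gx0 : 0 < g x0 by rewrite ltNge; apply/negP => /gh; rewrite /h hx0 eqxx.
have cross x : g x <= 0 -> exists y s, [/\ g y = 0, h y = s * h x & 0 <= s].
  move=> gx; have [|s /andP[s0 s1] gs] := @quadratic_fun_ivt R n A a a0 x x0 As.
    by rewrite gx ltW.
  exists (x + s *: (x0 - x)), (1 - s); split => //; last by rewrite subr_ge0.
  have -> : h (x + s *: (x0 - x)) = (1 - s) * h x + s * h x0.
    by rewrite /h -scaleN1r !form_linE; ring.
  by rewrite (hx0 : h x0 = 0) mulr0 addr0.
have gh0 y : g y = 0 -> h y != 0 by move=> gy; apply: gh; rewrite gy.
apply/separatesP; split=> //=.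
  have [y [s [gy hy s0]]] := cross u gu; exists y => //.
  by rewrite lt_neqAle gh0 //= hy mulr_ge0_le0 // ltW.
have [y [s [gy hy s0]]] := cross v gv; exists y => //.
by rewrite lt_neqAle eq_sym gh0 //= hy mulr_ge0 // ltW.
Qed.

Lemma separates_sublevel_of_zero (R : realType) n (g h : 'cV[R]_n -> R) :
  (forall x, h x = 0 -> 0 < g x) ->
  separates h [set x | g x = 0] -> separates h [set x | g x <= 0].
Proof.
move=> gpos /separatesP[/= _ [u gu hu] [v gv hv]]; apply/separatesP; split=> /=.
- by move=> x gx; apply: contraTneq gx => /gpos; rewrite ltNge.
- by exists u; rewrite ?gu.
- by exists v; rewrite ?gv.
Qed.

(** * Separation and the normal form *)

Lemma separates_normal_form (R : realType) n (A : 'M[R]_n.+1) a (a0 : R) b (b0 : R) :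
  A^T = A ->
  let g := quadratic_fun A a a0 in let h := fun x => dot b x + b0 in
  (forall x, h x = 0 -> 0 < g x) -> separates h [set x | g x = 0] ->
  exists (P : 'M[R]_n.+1) (p : 'cV[R]_n.+1) (mu : R) (m : nat) (delta : R)
         (c : nat -> R),
    [/\ P \in unitmx, 0 < mu, (1 <= m <= n.+1)%N & delta = 0 \/ delta = 1] /\
    [/\ forall y : 'cV[R]_n.+1,
          mu * g (P *m y + p) =
            - y 0 0 ^+ 2
            + delta * (\sum_(i < n.+1 | (1 <= i < m)%N) y i 0 ^+ 2) + 1,
        (forall y : 'cV[R]_n.+1,
          h (P *m y + p) =
            c 1%N * y 0 0
            + delta * (\sum_(i < n.+1 | (1 <= i < m)%N) c i.+1 * y i 0)
            + c 0%N)
        /\ c 1%N != 0,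
        forall x : 'cV[R]_n.+1, h x = 0 -> 0 < mu * g x &
        forall z : 'cV[R]_n,
          0 < - (delta * (\sum_(i < n | (i.+2 <= m)%N)
                            c i.+2 / c 1%N * z i 0) + c 0%N / c 1%N) ^+ 2
              + delta * (\sum_(i < n | (i.+2 <= m)%N) z i 0 ^+ 2) + 1].
Proof.
move=> As g h gpos /separatesP[/= _ [u gu hu] [v gv hv]].
have [||P [p [mu [m [c [[PU mu0 mn c1] E]]]]]] :=
    normalized_coordinates (normalized_separated As gpos _ _).
- by exists u; rewrite // -/g gu.
- by exists v; rewrite // -/g gv.
(* With [delta] = 1, the case of a single square is covered by [m] = 1, whose sums are empty. *)
exists P, p, mu, m, 1, c; split; first by split=> //; right.
have posg x : h x = 0 -> 0 < mu * g x by move=> /gpos; exact: mulr_gt0.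
split=> //.
- by move=> y; rewrite mul1r; case: (E y).
- by split=> // y; rewrite mul1r; case: (E y).
move=> z; rewrite !mul1r.
(* The first coordinate - t puts the point on the hyperplane; positivity there is the claimed
   inequality. *)
set t := (X in - X ^+ 2); pose y : 'cV[R]_(1 + n) := col_mx (- t)%:M z.
have y0 : y 0 0 = - t.
  have -> : (0 : 'I_n.+1) = lshift n (0 : 'I_1) by apply: val_inj.
  by rewrite col_mxEu mxE.
have yS (i : 'I_n) : y (lift ord0 i) 0 = z i 0.
  have -> : lift ord0 i = rshift 1 i by apply: val_inj.
  by rewrite col_mxEd.
have sumE (F : 'I_n.+1 -> R) : \sum_(i < n.+1 | (1 <= i < m)%N) F i =
    \sum_(i < n | (i.+2 <= m)%N) F (lift ord0 i).
  by rewrite big_mkcond big_ord_recl /= add0r -big_mkcond.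
have [gy hy] := E y; move: gy hy; rewrite !sumE y0 => gy hy.
have hy0 : h (P *m y + p) = 0.
  rewrite /h hy /t mulrN mulrDr mulr_sumr [c 1%N * (_ / _)]mulrC mulfVK //.
  rewrite [X in _ + X + _](_ : _ = \sum_(i < n | (i.+2 <= m)%N) c 1%N * (c i.+2 / c 1%N * z i 0)).
    by ring.
  by apply: eq_bigr => i _; rewrite yS lift0; field.
have := posg _ hy0; rewrite gy sqrrN.
rewrite (eq_bigr (fun i => z i 0 ^+ 2)) // => i _.
by rewrite yS.
Qed.

(** The points 1 and -1 of the first axis are zeros of [g], where [h] equals c_0 + c_1 and c_0 -
    c_1. These have opposite signs once |c_0| < |c_1|. Here [mu] may be negative, to absorb the sign
    [sigma]. *)
Lemma separates_of_normal_form (R : realType) n (g h : 'cV[R]_n.+1 -> R)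
    (P : 'M[R]_n.+1) (p : 'cV[R]_n.+1) (mu : R) (m : nat) (delta : R) (c : nat -> R) :
  mu != 0 ->
  (forall y : 'cV[R]_n.+1, mu * g (P *m y + p) =
    - y 0 0 ^+ 2 + delta * (\sum_(i < n.+1 | (1 <= i < m)%N) y i 0 ^+ 2) + 1) ->
  (forall y : 'cV[R]_n.+1, h (P *m y + p) =
    c 1%N * y 0 0 + delta * (\sum_(i < n.+1 | (1 <= i < m)%N) c i.+1 * y i 0) + c 0%N) ->
  (forall x : 'cV[R]_n.+1, h x = 0 -> 0 < mu * g x) ->
  c 1%N != 0 -> separates h [set x | g x = 0].
Proof.
move=> mu0 gE hE gpos c1.
pose e (t : R) : 'cV[R]_n.+1 := \col_i (if i == 0 then t else 0).
have eE t (i : 'I_n.+1) : (1 <= i < m)%N -> e t i 0 = 0.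
  by move=> /andP[i0 _]; rewrite mxE -val_eqE /= gtn_eqF.
have ge t : mu * g (P *m e t + p) = 1 - t ^+ 2.
  rewrite gE big1 => [|i /eE ->]; last by rewrite expr0n.
  by rewrite mxE mulr0 addr0 addrC.
have he t : h (P *m e t + p) = c 1%N * t + c 0%N.
  by rewrite hE big1 => [|i /eE ->]; rewrite ?mulr0 // mxE addr0.
(* Positivity is used at the point - c_0/c_1 of the first axis, where [h] vanishes. *)
have c01 : 0 < 1 - (c 0%N / c 1%N) ^+ 2.
  rewrite -sqrrN -ge gpos // he; field.
  exact: c1.
have cc : c 0%N ^+ 2 < c 1%N ^+ 2.
  by move: c01; rewrite subr_gt0 expr_div_n ltr_pdivrMr ?mul1r // exprn_even_gt0.
have g1 t : t ^+ 2 = 1 -> g (P *m e t + p) = 0.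
  move=> t2; apply/eqP; move/eqP: (ge t); rewrite t2 subrr mulf_eq0.
  by rewrite (negPf mu0).
have pos1 := g1 1 (expr1n _ _); have neg1 : g (P *m e (-1) + p) = 0 by apply: g1; rewrite sqrrN expr1n.
apply/separatesP; split=> /= [x gx||].
- by apply/eqP => /gpos; rewrite gx mulr0 ltxx.
- case: (ltP 0 (c 1%N)) => c1s; [exists (P *m e (-1) + p)|exists (P *m e 1 + p)] => //; rewrite he; nra.
- case: (ltP 0 (c 1%N)) => c1s; [exists (P *m e 1 + p)|exists (P *m e (-1) + p)] => //; rewrite he; nra.
Qed.

(* The dimension is [n.+1].  The coordinate [y_k] (1 <= k <= n+1) is
   [y i 0] with [i = k - 1], whereas the coefficient [c_k] is [c k]; only
   [c 0, ..., c m] occur.  In the last clause [z : 'cV[R]_n] stands for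
   [(y_2, ..., y_(n+1))], so that [y_k] is [z i 0] with [i = k - 2]. *)
Theorem lemma2p5 (R : realType) (n : nat)
    (A : 'M[R]_n.+1) (a : 'cV[R]_n.+1) (a0 : R)
    (f h : 'cV[R]_n.+1 -> R)
    (A_sym : A^T = A)
    (fE : forall x, f x = quadratic_fun A a a0 x)
    (f_nonconstant : ~ exists k : R, forall x, f x = k)
    (h_affine : affine_fun h) :
  (separates h [set x | f x = 0] <->
   exists sigma : R, (sigma = 1 \/ sigma = -1) /\
   exists (P : 'M[R]_n.+1) (p : 'cV[R]_n.+1) (mu : R) (m : nat) (delta : R)
          (c : nat -> R),
     [/\ P \in unitmx, 0 < mu, (1 <= m <= n.+1)%N & delta = 0 \/ delta = 1] /\
     [/\ forall y : 'cV[R]_n.+1,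
           sigma * mu * f (P *m y + p) =
             - y 0 0 ^+ 2
             + delta * (\sum_(i < n.+1 | (1 <= i < m)%N) y i 0 ^+ 2) + 1,
         (forall y : 'cV[R]_n.+1,
           h (P *m y + p) =
             c 1%N * y 0 0
             + delta * (\sum_(i < n.+1 | (1 <= i < m)%N) c i.+1 * y i 0)
             + c 0%N)
         /\ c 1%N != 0,
         forall x : 'cV[R]_n.+1, h x = 0 -> 0 < sigma * mu * f x &
         forall z : 'cV[R]_n,
           0 < - (delta * (\sum_(i < n | (i.+2 <= m)%N)
                             c i.+2 / c 1%N * z i 0) + c 0%N / c 1%N) ^+ 2
               + delta * (\sum_(i < n | (i.+2 <= m)%N) z i 0 ^+ 2) + 1])
  /\
  (separates h [set x | f x = 0] <->
   separates h [set x | f x <= 0] \/ separates h [set x | - f x <= 0]).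
Proof.
have [b [b0 hE]] := h_affine.
have {}fE : f = quadratic_fun A a a0 by apply/funext.
have {hE h_affine}hE : h = (fun x => dot b x + b0) by apply/funext.
subst f h; set f := quadratic_fun A a a0; set h := fun x => dot b x + b0.
have fN : (fun x => - f x) = quadratic_fun (- A) (- a) (- a0).
  by apply/funext => x; rewrite quadratic_fun_opp.
have AsN : (- A)^T = - A by rewrite raddfN /= A_sym.
have zeroN : [set x | f x = 0] = [set x | - f x = 0].
  by apply/seteqP; split=> x /= /eqP; rewrite ?oppr_eq0 => /eqP // ->; rewrite oppr0.
split; split.
- move=> sep; case: (separates_zero_sign A_sym sep) => fpos.
    exists 1; split; first by left.
    have [P [p [mu [m [delta [c NF]]]]]] := separates_normal_form A_sym fpos sep.
    by exists P, p, mu, m, delta, c; rewrite mul1r.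
  (* When [f] is negative on the hyperplane, the normal form is that of - f, whose zero set is the
     same. *)
  exists (-1); split; first by right.
  have sepN : separates h [set x | quadratic_fun (- A) (- a) (- a0) x = 0].
    by rewrite -fN -zeroN.
  have [|P [p [mu [m [delta [c NF]]]]]] := separates_normal_form AsN _ sepN.
    by rewrite -fN.
  exists P, p, mu, m, delta, c; move: NF; rewrite -fN mulN1r => -[? [gE hE gpos ?]].
  split=> //; split=> // [y|x hx]; first by rewrite -gE mulNr mulrN.
  by rewrite mulNr -mulrN gpos.
- move=> [sigma [s1 [P [p [mu [m [delta [c [[_ mu0 _ _] [gE [hE c1] gpos _]]]]]]]]]].
  apply: (separates_of_normal_form _ gE hE gpos c1).
  apply: mulf_neq0; last by rewrite gt_eqF.
  by case: s1 => ->; rewrite ?oppr_eq0 ?oner_neq0.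
- move=> sep; case: (separates_zero_sign A_sym sep) => fpos; [left|right].
    exact: separates_sublevel_of_zero.
  by apply: separates_sublevel_of_zero => //; rewrite -zeroN.
- case; first exact: separates_zero_of_sublevel.
  rewrite zeroN -[X in separates _ [set x | X x <= 0]]/(fun x => - f x).
  rewrite -[X in _ -> separates _ [set x | X x = 0]]/(fun x => - f x) fN.
  exact: separates_zero_of_sublevel.
Qed.
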